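(* Let $0<l_2\le l_1$ be real numbers, and put $$c^*=\tfrac12\left(l_1+l_2+\sqrt{l_1^2+l_2^2-l_1l_2}\right),\quad a^*=\frac{c^*}{2c^*/l_1-1},\quad b^*=\frac{c^*}{2c^*/l_2-1},\quad m_b^*=a^*+\tfrac12b^*.$$ For a real number $x$ consider the triangles $ABC$ with $l_a=l_2$, $l_b=l_1$ and $m_b=x$. If $l_1<x<m_b^*$, there exist exactly two such triangles. If $m_b^*\le x<\infty$ or $x=l_1$, there exists a unique such triangle. For all other values of $x$ no such triangle exists.
   Context: For a non-degenerate triangle $ABC$ in the Euclidean plane, $l_a$ and $l_b$ denote the lengths of the internal angle bisectors drawn from $A$ and $B$ respectively, measured from the vertex to the opposite side; $m_b$ is the length of the median from $B$ to the midpoint of $CA$. Triangles are counted up to congruence respecting the vertex labels. *)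

(* Defs.v *)
From Stdlib Require Import Reals.
Open Scope R_scope.

Definition point : Type := (R * R)%type.

Definition eucl_dist (P Q : point) : R := dist_euc (fst P) (snd P) (fst Q) (snd Q).

Definition dot (V P Q : point) : R :=
  (fst P - fst V) * (fst Q - fst V) + (snd P - snd V) * (snd Q - snd V).

(** Unoriented angle PVQ, in [0, PI]; meaningful when P and Q differ from V. *)
Definition angle (P V Q : point) : R :=
  acos (dot V P Q / (eucl_dist V P * eucl_dist V Q)).

Definition collinear (P Q S : point) : Prop :=
  exists p q r : R,
    (p <> 0 \/ q <> 0) /\
    p * fst P + q * snd P + r = 0 /\
    p * fst Q + q * snd Q + r = 0 /\
    p * fst S + q * snd S + r = 0.

Record plane_triangle : Type := PlaneTriangle {
  vA : point;
  vB : point;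
  vC : point;
  nondegenerate : ~ collinear vA vB vC
}.

Definition on_segment (P Q D : point) : Prop :=
  exists t : R, 0 <= t <= 1 /\
    D = ((1 - t) * fst P + t * fst Q, (1 - t) * snd P + t * snd Q).

(** The internal bisector of the angle at V of the triangle VPQ, cut off at the
    opposite side PQ, has length l.  Requiring its endpoint D to lie on the
    segment PQ is what selects the internal bisector. *)
Definition bisector_length (V P Q : point) (l : R) : Prop :=
  exists D : point,
    on_segment P Q D /\ angle P V D = angle D V Q /\ eucl_dist V D = l.

Definition midpoint (P Q : point) : point :=
  ((fst P + fst Q) / 2, (snd P + snd Q) / 2).

Definition bisector_A_length (T : plane_triangle) (l : R) : Prop :=
  bisector_length (vA T) (vB T) (vC T) l.

Definition bisector_B_length (T : plane_triangle) (l : R) : Prop :=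
  bisector_length (vB T) (vC T) (vA T) l.

Definition m_b (T : plane_triangle) : R := eucl_dist (vB T) (midpoint (vC T) (vA T)).

Definition isometry (f : point -> point) : Prop :=
  forall P Q : point, eucl_dist (f P) (f Q) = eucl_dist P Q.

(** Congruence respecting the labels; reflections are allowed. *)
Definition congruent (T T' : plane_triangle) : Prop :=
  exists f : point -> point,
    isometry f /\ f (vA T) = vA T' /\ f (vB T) = vB T' /\ f (vC T) = vC T'.

Definition no_triangle (P : plane_triangle -> Prop) : Prop :=
  forall T : plane_triangle, ~ P T.

Definition unique_up_to_congruence (P : plane_triangle -> Prop) : Prop :=
  exists T : plane_triangle, P T /\ forall T' : plane_triangle, P T' -> congruent T' T.

Definition exactly_two_up_to_congruence (P : plane_triangle -> Prop) : Prop :=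
  exists T1 T2 : plane_triangle,
    P T1 /\ P T2 /\ ~ congruent T1 T2 /\
    forall T : plane_triangle, P T -> congruent T T1 \/ congruent T T2.

(* Main.v *)
Require Import Defs.
From Stdlib Require Import Reals Lra Psatz Ranalysis5.
From Coquelicot Require Import Coquelicot.
Open Scope R_scope.

(** Put s = c + a and d = a - c.  Eliminating b from the formulas for m_b and l_b gives
    (s^2 - d^2) (4 m_b^2 - d^2) = 4 l_b^2 s^2, so with m_b = x and l_b = l1 fixed d^2 is a
    nondecreasing function of s > 2x, and vanishes identically exactly when x = l1.
    The bisector l_a satisfies l_a^2 = b c g (2 (b + c) - g) / (b + c)^2 with
    g = b + c - a = b - d, which increases in each of b, c and g; on each of the two
    branches d >= 0 and d <= 0 all three increase with s.  Hence l_a is strictly increasing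
    and unbounded on each branch, which therefore carries at most one triangle, and carries
    one if and only if l_a < l2 at the degenerate end s = 2x, |d| = b.  On the branch d >= 0
    this end has l_a = 0; on the branch d < 0 it is the flat triangle with c = a + b,
    where l_a is the harmonic mean of b and c, and l_a < l2 amounts to x < m_star. *)


(** * Comparison of squares and monotonicity of the bisector formula *)

Lemma pow2_lt_cancel (u v : R) : 0 <= v -> u ^ 2 < v ^ 2 -> u < v.
Proof. intros; nra. Qed.

Lemma pow2_le_cancel (u v : R) : 0 <= v -> u ^ 2 <= v ^ 2 -> u <= v.
Proof. intros; nra. Qed.

Lemma pow2_eq_cancel (u v : R) : 0 <= u -> 0 <= v -> u ^ 2 = v ^ 2 -> u = v.
Proof. intros; apply Rle_antisym; apply pow2_le_cancel; lra. Qed.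

Definition bisector_sq (b c g : R) : R := b * c * g * (2 * (b + c) - g) / (b + c) ^ 2.

Lemma bisector_sq_sym (b c g : R) : bisector_sq b c g = bisector_sq c b g.
Proof. unfold bisector_sq; rewrite (Rplus_comm c b); f_equal; ring. Qed.

(** With q = b + c the value is c g (1 - c/q) (2 - g/q); both bracketed factors are nonnegative and
    grow with q. *)
Lemma bisector_sq_le_l (b1 b2 c g : R) :
  0 < b1 -> b1 <= b2 -> 0 < c -> 0 <= g -> g <= b1 + c ->
  bisector_sq b1 c g <= bisector_sq b2 c g.
Proof.
intros Hb1 Hb Hc Hg Hgq.
assert (E : forall b, 0 < b ->
  bisector_sq b c g = c * g * ((1 - c / (b + c)) * (2 - g / (b + c)))).
{ intros b Hb0; unfold bisector_sq; field; lra. }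
rewrite !E by lra.
assert (I : / (b2 + c) <= / (b1 + c)) by (apply Rinv_le_contravar; lra).
assert (I2 : 0 < / (b2 + c)) by (apply Rinv_0_lt_compat; lra).
assert (Q : (b1 + c) * / (b1 + c) = 1) by (field; lra).
assert (I1 : 0 < / (b1 + c)) by (apply Rinv_0_lt_compat; lra).
apply Rmult_le_compat_l; [nra|].
unfold Rdiv; apply Rmult_le_compat; nra.
Qed.

(** Raise b, then c, then g. The last move is strict, since g (2 q - g) increases strictly for g <=
    q = b2 + c2. *)
Lemma bisector_sq_lt (b1 b2 c1 c2 g1 g2 : R) :
  0 < b1 -> b1 <= b2 -> 0 < c1 -> c1 <= c2 ->
  0 <= g1 -> g1 <= b1 + c1 -> g1 < g2 -> g2 <= b2 + c2 ->
  bisector_sq b1 c1 g1 < bisector_sq b2 c2 g2.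
Proof.
intros Hb1 Hb Hc1 Hc Hg1 Hq1 Hg Hq2.
apply Rle_lt_trans with (bisector_sq b2 c1 g1).
{ apply bisector_sq_le_l; lra. }
apply Rle_lt_trans with (bisector_sq b2 c2 g1).
{ rewrite !(bisector_sq_sym b2); apply bisector_sq_le_l; lra. }
unfold bisector_sq, Rdiv; apply Rmult_lt_compat_r.
{ apply Rinv_0_lt_compat, pow_lt; lra. }
rewrite !(Rmult_assoc (b2 * c2)); apply Rmult_lt_compat_l; nra.
Qed.

(** * The curve of triangles with given median and bisector from B *)

(** X = 4 m_b^2, L = 4 l_b^2, s = c + a and d = a - c.  Degenerate triangles, with |d| = b, are included. *)
Definition median_bisector_curve (X L s d b : R) : Prop :=
  0 < b /\ Rabs d <= b /\ b < s /\
  b ^ 2 = s ^ 2 + d ^ 2 - X /\ (s ^ 2 - d ^ 2) * (X - d ^ 2) = L * s ^ 2.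

(** Through b^2 = s^2 + d^2 - X, the bound b < s becomes d^2 < X, and |d| <= b becomes X <= s^2. *)
Lemma curve_bounds (X L s d b : R) :
  median_bisector_curve X L s d b -> d ^ 2 < X /\ X <= s ^ 2 /\ d ^ 2 < s ^ 2 /\ d <= b /\ - d <= b.
Proof.
intros (Hb & Hd & Hs & E1 & E2).
assert (Hd2 : d ^ 2 <= b ^ 2) by (rewrite <- !Rsqr_pow2; apply Rsqr_le_abs_1; rewrite (Rabs_right b); lra).
assert (- b <= d <= b) by (revert Hd; unfold Rabs; destruct (Rcase_abs d); lra).
repeat split; nra.
Qed.

(** The curve equation is quadratic in d^2. The difference of the two instances factors, and
    [curve_bounds] makes the cofactor of d1^2 - d2^2 positive. *)
Lemma curve_d_eq (X L s d1 d2 b1 b2 : R) :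
  median_bisector_curve X L s d1 b1 -> median_bisector_curve X L s d2 b2 -> d1 ^ 2 = d2 ^ 2.
Proof.
intros H1 H2.
pose proof (curve_bounds _ _ _ _ _ H1); pose proof (curve_bounds _ _ _ _ _ H2).
destruct H1 as (_ & _ & _ & _ & E1), H2 as (_ & _ & _ & _ & E2).
assert (P : (d1 ^ 2 - d2 ^ 2) * (X + s ^ 2 - d1 ^ 2 - d2 ^ 2) = 0) by lra.
apply Rmult_integral in P as [P|P]; lra.
Qed.

(** Divided by s^2, the equation reads (X - d^2) (1 - d^2/s^2) = L. If d^2 fell, both factors would
    rise; if d^2/s^2 rose while d^2 does not fall, the product would drop. *)
Lemma curve_d_le (X L s1 s2 d1 d2 b1 b2 : R) :
  0 < L -> s1 < s2 ->
  median_bisector_curve X L s1 d1 b1 -> median_bisector_curve X L s2 d2 b2 ->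
  d1 ^ 2 <= d2 ^ 2 /\ d2 ^ 2 * s1 ^ 2 <= d1 ^ 2 * s2 ^ 2.
Proof.
intros HL Hs H1 H2.
pose proof (curve_bounds _ _ _ _ _ H1) as B1; pose proof (curve_bounds _ _ _ _ _ H2) as B2.
destruct H1 as (Hb1 & _ & Hs1 & _ & E1), H2 as (_ & _ & _ & _ & E2).
assert (HS : s1 ^ 2 < s2 ^ 2) by nra.
assert (P1 : 0 < s1 ^ 2) by nra.
revert B1 B2 E1 E2 HS P1.
generalize (s1 ^ 2) (s2 ^ 2) (d1 ^ 2) (d2 ^ 2) (pow2_ge_0 d1) (pow2_ge_0 d2).
intros S1 S2 D1 D2 N1 N2 B1 B2 E1 E2 HS P1.
(* L S1 S2 computed from both points *)
assert (E : (X - D1) * ((S1 - D1) * S2) = (X - D2) * ((S2 - D2) * S1)) by nra.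
assert (F : D1 <= D2).
{ destruct (Rle_or_lt D1 D2) as [|C]; [assumption|exfalso].
  assert ((S1 - D1) * S2 <= (S2 - D2) * S1) by nra.
  assert (0 < (S2 - D2) * S1) by nra.
  nra. }
split; [exact F|].
destruct (Rle_or_lt (D2 * S1) (D1 * S2)) as [|C]; [assumption|exfalso].
assert (0 < (S2 - D2) * S1) by nra.
nra.
Qed.

(** For d <= 0, both c and b - d grow because - d does not decrease. For d >= 0, c = s (1 - d/s) / 2
    grows because d/s does not increase. *)
Lemma curve_bisector_lt (X L s1 s2 d1 d2 b1 b2 : R) :
  0 < L -> s1 < s2 ->
  median_bisector_curve X L s1 d1 b1 -> median_bisector_curve X L s2 d2 b2 ->
  (0 <= d1 /\ 0 <= d2) \/ (d1 <= 0 /\ d2 <= 0) ->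
  bisector_sq b1 ((s1 - d1) / 2) (b1 - d1) < bisector_sq b2 ((s2 - d2) / 2) (b2 - d2).
Proof.
intros HL Hs H1 H2 Hsign.
destruct (curve_d_le _ _ _ _ _ _ _ _ HL Hs H1 H2) as [D W].
pose proof (curve_bounds _ _ _ _ _ H1) as B1; pose proof (curve_bounds _ _ _ _ _ H2) as B2.
destruct H1 as (Hb1 & _ & Hs1 & Q1 & E1), H2 as (Hb2 & _ & Hs2 & Q2 & E2).
assert (Hb : b1 < b2) by (apply pow2_lt_cancel; nra).
assert (Hcg : s1 - d1 < s2 - d2 /\ b1 - d1 < b2 - d2).
{ destruct Hsign as [[Hd1 Hd2]|[Hd1 Hd2]].
  - assert (d1 <= d2) by (apply pow2_le_cancel; lra).
    assert (d2 * s1 <= d1 * s2) by (apply pow2_le_cancel; nra).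
    assert (d1 < s1) by lra.
    assert (Hc : s1 - d1 < s2 - d2) by nra.
    split; [exact Hc|].
    (* otherwise s2^2 - s1^2 <= 2 (b1 - d1) (d2 - d1), against s2 - s1 > d2 - d1 *)
    destruct (Rle_or_lt (b2 - d2) (b1 - d1)) as [C|]; [exfalso|assumption].
    assert (b2 ^ 2 <= (b1 - d1 + d2) ^ 2) by (apply pow_incr; lra).
    assert (s2 ^ 2 - s1 ^ 2 <= 2 * (b1 - d1) * (d2 - d1)) by nra.
    assert (2 * (b1 - d1) * (d2 - d1) <= (s1 + s2) * (d2 - d1)) by (apply Rmult_le_compat_r; lra).
    nra.
  - assert (- d1 <= - d2) by (apply pow2_le_cancel; nra).
    lra. }
apply bisector_sq_lt; lra.
Qed.


(** * Curve points with prescribed l_a, by the intermediate value theorem *)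

Lemma continuity_sqrt_comp (f : R -> R) : continuity f -> continuity (fun s => sqrt (f s)).
Proof.
intros Hf s.
apply (continuity_pt_comp f sqrt s (Hf s)).
apply continuity_pt_filterlim, continuous_sqrt.
Qed.

(** The smaller root of the curve equation as a quadratic in d^2, with discriminant (X + s^2)^2 - 4
    s^2 (X - L). *)
Definition curve_dsq (X L s : R) : R := (X + s ^ 2 - sqrt ((X - s ^ 2) ^ 2 + 4 * s ^ 2 * L)) / 2.

Lemma curve_dsq_spec (X L s : R) (D := curve_dsq X L s) :
  0 < L -> L <= X -> X <= s ^ 2 ->
  0 <= D /\ D < X /\ (s ^ 2 - D) * (X - D) = L * s ^ 2 /\ (L < X -> 0 < D).
Proof.
intros HL HX Hs; unfold D, curve_dsq; clear D.
revert Hs; generalize (s ^ 2); intros S HS.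
assert (N : 0 <= (X - S) ^ 2 + 4 * S * L) by nra.
pose proof (sqrt_sqrt _ N) as Q; pose proof (sqrt_pos ((X - S) ^ 2 + 4 * S * L)) as P.
set (r := sqrt _) in *.
assert (r <= X + S) by (apply pow2_le_cancel; nra).
assert (S - X < r) by (apply pow2_lt_cancel; nra).
repeat split; try nra.
Qed.

(** The difference l_a^2 - l^2 multiplied by (2 b + s - d)^2, which clears the denominator of
    [bisector_sq]. *)
Definition bisector_gap (l s d b : R) : R :=
  2 * b * (s - d) * (s + b) * (b - d) - l ^ 2 * (2 * b + s - d) ^ 2.

(** The sign [sg] selects the branch. The gap is negative at the degenerate end s = 2x, where b =
    |d|, and positive for large s. *)
Lemma curve_exists (x l1 l2 sg : R) (d0 := sg * sqrt (curve_dsq (4 * x ^ 2) (4 * l1 ^ 2) (2 * x))) :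
  0 < l1 -> 0 < l2 -> l1 <= x -> sg ^ 2 = 1 ->
  bisector_gap l2 (2 * x) d0 (Rabs d0) < 0 ->
  exists s d b, bisector_gap l2 s d b = 0 /\
    0 <= sg * d /\ (l1 < x -> d <> 0) /\ 0 < b /\ d ^ 2 < b ^ 2 /\ b < s /\
    b ^ 2 = s ^ 2 + d ^ 2 - 4 * x ^ 2 /\
    (s ^ 2 - d ^ 2) * (4 * x ^ 2 - d ^ 2) = 4 * l1 ^ 2 * s ^ 2.
Proof.
intros Hl1 Hl2 Hx Hsg H0.
pose (D := curve_dsq (4 * x ^ 2) (4 * l1 ^ 2)).
pose (d := fun s => sg * sqrt (D s)).
pose (b := fun s => sqrt (s ^ 2 + D s - 4 * x ^ 2)).
pose (G := fun s => bisector_gap l2 s (d s) (b s)).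
assert (cD : continuity D).
{ unfold D, curve_dsq.
  pose proof (continuity_sqrt_comp (fun s => (4 * x ^ 2 - s ^ 2) ^ 2 + 4 * s ^ 2 * (4 * l1 ^ 2)) ltac:(reg)) as C.
  intros s; specialize (C s); cbv beta in C.
  unfold Rdiv; apply continuity_pt_mult; [|reg].
  apply continuity_pt_minus; [reg|exact C]. }
assert (cd : continuity d).
{ unfold d; intros s; apply continuity_pt_mult; [reg|apply (continuity_sqrt_comp D cD s)]. }
assert (cb : continuity b).
{ unfold b; apply continuity_sqrt_comp; intros s.
  apply continuity_pt_minus; [apply continuity_pt_plus; [reg|apply cD]|reg]. }
assert (cG : continuity G).
{ clearbody d b; unfold G, bisector_gap; intros s.
  pose proof (cd s); pose proof (cb s).
  reg. }
assert (K : forall s, 2 * x <= s ->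
  let r := D s in 0 <= r /\ r < 4 * x ^ 2 /\ (s ^ 2 - r) * (4 * x ^ 2 - r) = 4 * l1 ^ 2 * s ^ 2 /\
  (l1 < x -> 0 < r) /\ d s ^ 2 = r /\ 0 <= b s /\ b s ^ 2 = s ^ 2 + r - 4 * x ^ 2).
{ intros s Hs r.
  destruct (curve_dsq_spec (4 * x ^ 2) (4 * l1 ^ 2) s) as (A1 & A2 & A3 & A4); [nra..|].
  fold D in A1, A2, A3, A4; fold r in A1, A2, A3, A4.
  repeat split; try assumption.
  - intros; apply A4; nra.
  - unfold d; rewrite Rpow_mult_distr, Hsg, pow2_sqrt; [unfold r; ring|exact A1].
  - apply sqrt_pos.
  - unfold b; rewrite pow2_sqrt; [reflexivity|fold r; nra]. }
(* At the right end |d| <= s/4, s/2 <= b <= s and l2 <= s/10, so the positive term of the gap is at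
   least (3/16) s^4 and the subtracted one at most (4/25) s^4. *)
destruct (IVT_interv G (2 * x) (8 * x + 10 * l2)) as [z [Hz Ez]].
- intros a _; apply cG.
- lra.
- unfold G; replace (b (2 * x)) with (Rabs (d (2 * x))); [exact H0|].
  destruct (K (2 * x)) as (_ & _ & _ & _ & K1 & K2 & K3); [lra|].
  apply pow2_eq_cancel; [apply Rabs_pos|exact K2|].
  rewrite pow2_abs, K1, K3; ring.
- set (s := 8 * x + 10 * l2).
  destruct (K s) as (A1 & A2 & _ & _ & K1 & K2 & K3); [unfold s; lra|].
  unfold G; revert K1 K2 K3; generalize (d s) (b s); intros e c K1 K2 K3.
  rewrite <- K1 in *.
  assert (Hs8 : 8 * x <= s) by (unfold s; lra).
  assert (Hs10 : 10 * l2 <= s) by (unfold s; lra).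
  assert (Hs : 0 < s) by lra.
  assert (c <= s) by (apply pow2_le_cancel; nra).
  assert (s / 2 <= c) by (apply pow2_le_cancel; nra).
  assert (e <= s / 4) by (apply pow2_le_cancel; nra).
  assert (- e <= s / 4) by (apply pow2_le_cancel; nra).
  unfold bisector_gap.
  assert (P1 : (s * (3 / 4 * s)) * (s * (s / 4)) <= (2 * c * (s - e)) * ((s + c) * (c - e))).
  { apply Rmult_le_compat; try nra; apply Rmult_le_compat; nra. }
  assert (P2 : l2 ^ 2 * (2 * c + s - e) ^ 2 <= (s / 10) ^ 2 * (4 * s) ^ 2).
  { apply Rmult_le_compat; try apply pow2_ge_0; apply pow_incr; lra. }
  assert (0 < s ^ 4) by (apply pow_lt; lra).
  nra.
- exists z, (d z), (b z).
  (* The root is not the degenerate end, where the gap is negative; z > 2x then gives d^2 < b^2. *)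
  assert (Hz2 : 2 * x < z).
  { destruct (Req_dec z (2 * x)) as [E|]; [exfalso|lra].
    enough (G (2 * x) < 0) by (rewrite <- E in *; lra).
    unfold G; replace (b (2 * x)) with (Rabs (d (2 * x))); [exact H0|].
    destruct (K (2 * x)) as (_ & _ & _ & _ & K1 & K2 & K3); [lra|].
    apply pow2_eq_cancel; [apply Rabs_pos|exact K2|].
    rewrite pow2_abs, K1, K3; ring. }
  destruct (K z) as (A1 & A2 & A3 & A4 & K1 & K2 & K3); [lra|].
  assert (0 < b z) by (destruct K2 as [|K2]; [assumption|rewrite <- K2 in K3; nra]).
  rewrite <- K1 in A1, A2, A3, A4, K3.
  repeat split.
  + exact Ez.
  + unfold d; rewrite <- Rmult_assoc; replace (sg * sg) with 1 by lra.
    rewrite Rmult_1_l; apply sqrt_pos.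
  + intros Hlt E; specialize (A4 Hlt); rewrite E in A4; lra.
  + assumption.
  + nra.
  + apply pow2_lt_cancel; nra.
  + exact K3.
  + exact A3.
Qed.


(** * Distances, scalar and cross products, and angles in the plane *)

Lemma pow2_pos (u : R) : u <> 0 -> 0 < u ^ 2.
Proof. intros H; rewrite <- Rsqr_pow2; apply Rsqr_pos_lt, H. Qed.

Lemma eucl_dist_ge_0 (P Q : point) : 0 <= eucl_dist P Q.
Proof. apply sqrt_pos. Qed.

Lemma eucl_dist_sq (P Q : point) :
  eucl_dist P Q ^ 2 = (fst P - fst Q) ^ 2 + (snd P - snd Q) ^ 2.
Proof.
unfold eucl_dist, dist_euc; rewrite pow2_sqrt, !Rsqr_pow2; [reflexivity|].
apply Rplus_le_le_0_compat; apply Rle_0_sqr.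
Qed.

Lemma eucl_dist_eq (P Q : point) (l : R) :
  0 <= l -> (fst P - fst Q) ^ 2 + (snd P - snd Q) ^ 2 = l ^ 2 -> eucl_dist P Q = l.
Proof.
intros Hl E; apply pow2_eq_cancel; [apply eucl_dist_ge_0|exact Hl|].
rewrite eucl_dist_sq; exact E.
Qed.

Lemma eucl_dist_sym (P Q : point) : eucl_dist P Q = eucl_dist Q P.
Proof. apply eucl_dist_eq; [apply eucl_dist_ge_0|rewrite eucl_dist_sq; ring]. Qed.

(** Twice the signed area of the triangle VPQ. *)
Definition cross (V P Q : point) : R :=
  (fst P - fst V) * (snd Q - snd V) - (snd P - snd V) * (fst Q - fst V).

Lemma cross_rot (V P Q : point) : cross P Q V = cross V P Q.
Proof. unfold cross; ring. Qed.

Lemma collinear_iff_cross (P Q S : point) : collinear P Q S <-> cross P Q S = 0.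
Proof.
destruct P as [p1 p2], Q as [q1 q2], S as [s1 s2]; unfold collinear, cross; simpl.
split.
- intros (p & q & r & Hpq & E1 & E2 & E3).
  assert (F1 : p * (q1 - p1) + q * (q2 - p2) = 0) by lra.
  assert (F2 : p * (s1 - p1) + q * (s2 - p2) = 0) by lra.
  destruct Hpq as [H|H]; apply (Rmult_eq_reg_l _ _ _) with (2 := H).
  + transitivity ((p * (q1 - p1) + q * (q2 - p2)) * (s2 - p2) - (p * (s1 - p1) + q * (s2 - p2)) * (q2 - p2));
      [ring|rewrite F1, F2; ring].
  + transitivity ((p * (s1 - p1) + q * (s2 - p2)) * (q1 - p1) - (p * (q1 - p1) + q * (q2 - p2)) * (s1 - p1));
      [ring|rewrite F1, F2; ring].
- intros E.
  destruct (Req_dec p1 q1) as [e1|n1]; [destruct (Req_dec p2 q2) as [e2|n2]|].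
  + subst; destruct (Req_dec q1 s1) as [e1|n1]; [destruct (Req_dec q2 s2) as [e2|n2]|].
    (* All three points coincide, and the vertical line through them serves. *)
    * subst; exists 1, 0, (- s1); repeat split; lra.
    * exists (q2 - s2), (s1 - q1), (- ((q2 - s2) * q1 + (s1 - q1) * q2)); repeat split; try lra; nra.
    * exists (q2 - s2), (s1 - q1), (- ((q2 - s2) * q1 + (s1 - q1) * q2)); repeat split; try lra; nra.
  + exists (p2 - q2), (q1 - p1), (- ((p2 - q2) * p1 + (q1 - p1) * p2)); repeat split; try lra; nra.
  + exists (p2 - q2), (q1 - p1), (- ((p2 - q2) * p1 + (q1 - p1) * p2)); repeat split; try lra; nra.
Qed.

Lemma dot_eucl_dist (V P Q : point) :
  2 * dot V P Q = eucl_dist V P ^ 2 + eucl_dist V Q ^ 2 - eucl_dist P Q ^ 2.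
Proof. rewrite !eucl_dist_sq; unfold dot; ring. Qed.

(** Lagrange's identity, the source of Cauchy-Schwarz and of its strict form for non-collinear
    points. *)
Lemma dot_cross (V P Q : point) :
  dot V P Q ^ 2 + cross V P Q ^ 2 = (eucl_dist V P * eucl_dist V Q) ^ 2.
Proof. rewrite Rpow_mult_distr, !eucl_dist_sq; unfold dot, cross; ring. Qed.

Lemma dot_bounds (V P Q : point) :
  - (eucl_dist V P * eucl_dist V Q) <= dot V P Q <= eucl_dist V P * eucl_dist V Q.
Proof.
pose proof (dot_cross V P Q) as E; pose proof (pow2_ge_0 (cross V P Q)).
assert (0 <= eucl_dist V P * eucl_dist V Q) by (apply Rmult_le_pos; apply eucl_dist_ge_0).
split; [apply Ropp_le_cancel; rewrite Ropp_involutive|]; apply pow2_le_cancel; nra.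
Qed.

Lemma dot_lt (V P Q : point) :
  cross V P Q <> 0 -> dot V P Q < eucl_dist V P * eucl_dist V Q.
Proof.
intros H; pose proof (dot_cross V P Q) as E; pose proof (pow2_pos _ H).
assert (0 <= eucl_dist V P * eucl_dist V Q) by (apply Rmult_le_pos; apply eucl_dist_ge_0).
apply pow2_lt_cancel; nra.
Qed.

Lemma eucl_dist_pos (V P Q : point) : cross V P Q <> 0 -> 0 < eucl_dist V P.
Proof.
intros H; destruct (eucl_dist_ge_0 V P) as [|E]; [assumption|exfalso; apply H].
pose proof (eucl_dist_sq V P) as S; rewrite <- E in S.
pose proof (pow2_ge_0 (fst V - fst P)); pose proof (pow2_ge_0 (snd V - snd P)).
assert (fst V - fst P = 0) by nra; assert (snd V - snd P = 0) by nra.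
unfold cross; nra.
Qed.

(** By Cauchy-Schwarz both cosines lie in [-1, 1], where [acos] is injective; the common factor
    [eucl_dist V D] then cancels. *)
Lemma angle_eq_iff (V P D Q : point) :
  0 < eucl_dist V P -> 0 < eucl_dist V D -> 0 < eucl_dist V Q ->
  (angle P V D = angle D V Q <-> dot V P D * eucl_dist V Q = dot V D Q * eucl_dist V P).
Proof.
intros HP HD HQ; unfold angle.
assert (B : forall S T, 0 < eucl_dist V S -> 0 < eucl_dist V T ->
  -1 <= dot V S T / (eucl_dist V S * eucl_dist V T) <= 1).
{ intros S T HS HT; destruct (dot_bounds V S T) as [B1 B2].
  assert (M : 0 < eucl_dist V S * eucl_dist V T) by (apply Rmult_lt_0_compat; assumption).
  split; [apply Rle_div_r|apply Rle_div_l]; lra. }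
assert (E : dot V P D / (eucl_dist V P * eucl_dist V D) = dot V D Q / (eucl_dist V D * eucl_dist V Q)
  <-> dot V P D * eucl_dist V Q = dot V D Q * eucl_dist V P).
{ split; intros H.
  - replace (dot V P D) with (dot V P D / (eucl_dist V P * eucl_dist V D) * (eucl_dist V P * eucl_dist V D))
      by (field; lra).
    rewrite H; field; lra.
  - apply (Rmult_eq_reg_r (eucl_dist V P * eucl_dist V D * eucl_dist V Q));
      [|apply Rgt_not_eq; repeat apply Rmult_lt_0_compat; assumption].
    transitivity (dot V P D * eucl_dist V Q); [field; lra|].
    rewrite H; field; lra. }
rewrite <- E; split; intros H.
- rewrite <- (cos_acos (dot V P D / _)), <- (cos_acos (dot V D Q / _)), H by auto; reflexivity.
- rewrite H; reflexivity.
Qed.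

(** For a point with parameter t on PQ, equality of the angles factors as (p q - dot) (p - t (p +
    q)) = 0 with a positive first factor. Hence t = p / (p + q), and the law of cosines yields the
    length. *)
Lemma bisector_length_iff (V P Q : point) (l : R)
    (p := eucl_dist V P) (q := eucl_dist V Q) :
  cross V P Q <> 0 ->
  (bisector_length V P Q l <->
   0 <= l /\ l ^ 2 * (p + q) ^ 2 = p * q * ((p + q) ^ 2 - eucl_dist P Q ^ 2)).
Proof.
intros H.
assert (Hp : 0 < p) by exact (eucl_dist_pos _ _ _ H).
assert (Hq : 0 < q).
{ apply (eucl_dist_pos V Q P); intros E; apply H; rewrite <- (Ropp_involutive (cross _ _ _)).
  rewrite <- Ropp_0; f_equal; rewrite <- E; unfold cross; ring. }
pose proof (dot_lt V P Q H) as HK; fold p q in HK.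
pose proof (dot_eucl_dist V P Q) as EK; fold p q in EK.
set (D := fun t => ((1 - t) * fst P + t * fst Q, (1 - t) * snd P + t * snd Q)).
assert (D1 : forall t, dot V P (D t) = (1 - t) * p ^ 2 + t * dot V P Q).
{ intros t; unfold p; rewrite eucl_dist_sq; unfold dot, D; simpl; ring. }
assert (D2 : forall t, dot V (D t) Q = (1 - t) * dot V P Q + t * q ^ 2).
{ intros t; unfold q; rewrite eucl_dist_sq; unfold dot, D; simpl; ring. }
assert (D3 : forall t, eucl_dist V (D t) ^ 2
   = (1 - t) ^ 2 * p ^ 2 + 2 * (t * (1 - t)) * dot V P Q + t ^ 2 * q ^ 2).
{ intros t; unfold p, q; rewrite !eucl_dist_sq; unfold dot, D; simpl; ring. }
(* The line PQ misses V, so the angles at V are meaningful. *)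
assert (D4 : forall t, 0 < eucl_dist V (D t)).
{ intros t; destruct (Req_dec t 0) as [->|Ht].
  - apply pow2_lt_cancel; [apply eucl_dist_ge_0|].
    rewrite D3; nra.
  - apply (eucl_dist_pos V (D t) P).
    intros E; apply H; apply (Rmult_eq_reg_l t); [|exact Ht].
    rewrite Rmult_0_r, <- Ropp_0, <- E; unfold cross, D; simpl; ring. }
assert (A : forall t, angle P V (D t) = angle (D t) V Q <-> t * (p + q) = p).
{ intros t; rewrite angle_eq_iff; fold p q; auto.
  rewrite D1, D2.
  assert (I : ((1 - t) * p ^ 2 + t * dot V P Q) * q - ((1 - t) * dot V P Q + t * q ^ 2) * p
    = (p * q - dot V P Q) * (p - t * (p + q))) by ring.
  split; intros E.
  - assert (Z : (p * q - dot V P Q) * (p - t * (p + q)) = 0) by lra.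
    apply Rmult_integral in Z as [Z|Z]; lra.
  - rewrite E in I; lra. }
assert (N : forall t, t * (p + q) = p ->
  eucl_dist V (D t) ^ 2 * (p + q) ^ 2 = p * q * ((p + q) ^ 2 - eucl_dist P Q ^ 2)).
{ intros t Ht; rewrite D3.
  replace (((1 - t) ^ 2 * p ^ 2 + 2 * (t * (1 - t)) * dot V P Q + t ^ 2 * q ^ 2) * (p + q) ^ 2)
    with (((p + q) - t * (p + q)) ^ 2 * p ^ 2
          + t * (p + q) * ((p + q) - t * (p + q)) * (2 * dot V P Q) + (t * (p + q)) ^ 2 * q ^ 2) by ring.
  rewrite Ht, EK; ring. }
unfold bisector_length; split.
- intros (S & (t & Ht & ->) & HA & <-); fold (D t) in *.
  split; [apply eucl_dist_ge_0|apply N, A, HA].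
- intros [Hl E].
  exists (D (p / (p + q))).
  assert (Ht : p / (p + q) * (p + q) = p) by (field; lra).
  split; [exists (p / (p + q)); split; [nra|reflexivity]|].
  split; [apply A, Ht|].
  apply pow2_eq_cancel; [apply eucl_dist_ge_0|exact Hl|].
  apply (Rmult_eq_reg_r ((p + q) ^ 2)); [|nra].
  rewrite E; apply N, Ht.
Qed.

(** * Triangles and their side lengths *)

Definition side_a (T : plane_triangle) : R := eucl_dist (vB T) (vC T).
Definition side_b (T : plane_triangle) : R := eucl_dist (vC T) (vA T).
Definition side_c (T : plane_triangle) : R := eucl_dist (vA T) (vB T).

Lemma triangle_cross (T : plane_triangle) : cross (vA T) (vB T) (vC T) <> 0.
Proof. intros E; apply (nondegenerate T), collinear_iff_cross, E. Qed.

(** Strict Cauchy-Schwarz on both sides and the law of cosines give (b - c)^2 < a^2 < (b + c)^2. *)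
Lemma triangle_sides (T : plane_triangle) (a := side_a T) (b := side_b T) (c := side_c T) :
  0 < a /\ 0 < b /\ 0 < c /\ a < b + c /\ b < c + a /\ c < a + b.
Proof.
pose proof (triangle_cross T) as H.
assert (Ha : 0 < a) by (apply (eucl_dist_pos _ _ (vA T)); rewrite cross_rot; exact H).
assert (Hb : 0 < b) by (apply (eucl_dist_pos _ _ (vB T)); rewrite <- cross_rot; exact H).
assert (Hc : 0 < c) by (apply (eucl_dist_pos _ _ (vC T)); exact H).
pose proof (dot_lt (vA T) (vB T) (vC T) H) as K1.
pose proof (dot_bounds (vA T) (vB T) (vC T)) as [K2 _].
pose proof (dot_cross (vA T) (vB T) (vC T)) as K3.
pose proof (pow2_pos _ H) as K4.
pose proof (dot_eucl_dist (vA T) (vB T) (vC T)) as K5.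
rewrite (eucl_dist_sym (vA T) (vC T)) in *.
unfold side_a, side_b, side_c in *; fold a b c in K1, K2, K3, K5.
set (k := dot _ _ _) in *.
assert (- (c * b) < k) by (destruct (Req_dec k (- (c * b))) as [E|]; [rewrite E in K3; nra|lra]).
repeat split; try assumption.
- apply pow2_lt_cancel; nra.
- assert ((b - c) ^ 2 < a ^ 2) by nra. apply Rnot_le_lt; intros; nra.
- assert ((b - c) ^ 2 < a ^ 2) by nra. apply Rnot_le_lt; intros; nra.
Qed.

(** Apollonius' theorem. *)
Lemma m_b_iff (T : plane_triangle) (x : R) :
  m_b T = x <-> 0 <= x /\ 4 * x ^ 2 = 2 * side_a T ^ 2 + 2 * side_c T ^ 2 - side_b T ^ 2.
Proof.
assert (E : 4 * m_b T ^ 2 = 2 * side_a T ^ 2 + 2 * side_c T ^ 2 - side_b T ^ 2).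
{ unfold m_b, side_a, side_b, side_c; rewrite !eucl_dist_sq; unfold midpoint; simpl; field. }
split.
- intros <-; split; [apply eucl_dist_ge_0|exact E].
- intros [Hx F]; apply pow2_eq_cancel; [apply eucl_dist_ge_0|exact Hx|lra].
Qed.

(** Take A = (0, 0), B = (c, 0) and C = (p, h), with p from the law of cosines; the triangle
    inequalities give |p| < b, hence a positive height h. *)
Lemma triangle_exists (a b c : R) :
  0 < a -> 0 < b -> 0 < c -> a < b + c -> b < c + a -> c < a + b ->
  exists T, side_a T = a /\ side_b T = b /\ side_c T = c.
Proof.
intros Ha Hb Hc H1 H2 H3.
set (p := (b ^ 2 + c ^ 2 - a ^ 2) / (2 * c)).
assert (Ep : 2 * c * p = b ^ 2 + c ^ 2 - a ^ 2) by (unfold p; field; lra).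
assert (Hp : 0 < b ^ 2 - p ^ 2).
{ assert (- b < p) by (apply (Rmult_lt_reg_l (2 * c)); nra).
  assert (p < b) by (apply (Rmult_lt_reg_l (2 * c)); nra).
  nra. }
assert (Hh := sqrt_lt_R0 _ Hp); assert (Eh := pow2_sqrt _ (Rlt_le _ _ Hp)).
set (h := sqrt _) in *; clearbody h p.
assert (N : ~ collinear (0, 0) (c, 0) (p, h)).
{ rewrite collinear_iff_cross; unfold cross; simpl; nra. }
exists (PlaneTriangle _ _ _ N); unfold side_a, side_b, side_c; simpl.
repeat split; apply eucl_dist_eq; simpl; try lra; nra.
Qed.

Lemma congruent_sides (T T' : plane_triangle) :
  congruent T T' -> side_a T = side_a T' /\ side_b T = side_b T' /\ side_c T = side_c T'.
Proof.
unfold side_a, side_b, side_c; intros (f & Hf & <- & <- & <-); rewrite !Hf; auto.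
Qed.

(** The affine map sending one triangle to the other preserves distances, because the squared length
    of y AB + z AC is determined by y, z and the three sides. *)
Lemma sides_congruent (T T' : plane_triangle) :
  side_a T = side_a T' -> side_b T = side_b T' -> side_c T = side_c T' -> congruent T T'.
Proof.
intros Ea Eb Ec; pose proof (triangle_cross T) as H.
apply (f_equal (fun r => r ^ 2)) in Ea, Eb, Ec.
unfold side_a, side_b, side_c in *; rewrite !eucl_dist_sq in *.
unfold congruent; revert H Ea Eb Ec; generalize (vA T) (vB T) (vC T) (vA T') (vB T') (vC T').
intros [a1 a2] [b1 b2] [c1 c2] [a1' a2'] [b1' b2'] [c1' c2']; unfold cross; simpl fst; simpl snd.
set (k := _ - _); intros H Ea Eb Ec.
(* affine coordinates in the frame A, AB, AC are carried over to the frame of T' *)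
set (u := fun w1 w2 => (w1 * (c2 - a2) - w2 * (c1 - a1)) / k).
set (v := fun w1 w2 => ((b1 - a1) * w2 - (b2 - a2) * w1) / k).
exists (fun P => let w1 := fst P - a1 in let w2 := snd P - a2 in
  (a1' + u w1 w2 * (b1' - a1') + v w1 w2 * (c1' - a1'),
   a2' + u w1 w2 * (b2' - a2') + v w1 w2 * (c2' - a2'))).
split; [|unfold u, v; simpl; repeat split; f_equal; unfold k in *; field; exact H].
intros [p1 p2] [q1 q2].
apply eucl_dist_eq; [apply eucl_dist_ge_0|rewrite eucl_dist_sq]; simpl fst; simpl snd.
set (w1 := p1 - q1); set (w2 := p2 - q2).
assert (U : u (p1 - a1) (p2 - a2) = u (q1 - a1) (q2 - a2) + u w1 w2) by (unfold u, w1, w2; field; exact H).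
assert (V : v (p1 - a1) (p2 - a2) = v (q1 - a1) (q2 - a2) + v w1 w2) by (unfold v, w1, w2; field; exact H).
rewrite U, V.
assert (W1 : w1 = u w1 w2 * (b1 - a1) + v w1 w2 * (c1 - a1)) by (unfold u, v, k in *; field; exact H).
assert (W2 : w2 = u w1 w2 * (b2 - a2) + v w1 w2 * (c2 - a2)) by (unfold u, v, k in *; field; exact H).
assert (W : w1 ^ 2 + w2 ^ 2 = (u w1 w2 * (b1 - a1) + v w1 w2 * (c1 - a1)) ^ 2
  + (u w1 w2 * (b2 - a2) + v w1 w2 * (c2 - a2)) ^ 2) by (rewrite <- W1, <- W2; reflexivity).
rewrite W.
clear U V W W1 W2; generalize (u w1 w2) (v w1 w2) (u (q1 - a1) (q2 - a2)) (v (q1 - a1) (q2 - a2)).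
intros y z y0 z0.
(* Polarisation: twice the scalar product of AB and AC is AB^2 + AC^2 - BC^2. *)
transitivity (y ^ 2 * ((a1' - b1') ^ 2 + (a2' - b2') ^ 2) + z ^ 2 * ((c1' - a1') ^ 2 + (c2' - a2') ^ 2)
  + y * z * (((a1' - b1') ^ 2 + (a2' - b2') ^ 2) + ((c1' - a1') ^ 2 + (c2' - a2') ^ 2)
             - ((b1' - c1') ^ 2 + (b2' - c2') ^ 2))); [ring|].
rewrite <- Ea, <- Eb, <- Ec; ring.
Qed.


(** * Triangles as points of the curve *)

Definition admissible (l1 l2 x : R) (T : plane_triangle) : Prop :=
  bisector_A_length T l2 /\ bisector_B_length T l1 /\ m_b T = x.

Lemma admissible_iff_sides (l1 l2 x : R) (T : plane_triangle)
    (a := side_a T) (b := side_b T) (c := side_c T) :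
  0 <= l1 -> 0 <= l2 ->
  (admissible l1 l2 x T <->
   l2 ^ 2 * (c + b) ^ 2 = c * b * ((c + b) ^ 2 - a ^ 2) /\
   l1 ^ 2 * (a + c) ^ 2 = a * c * ((a + c) ^ 2 - b ^ 2) /\
   0 <= x /\ 4 * x ^ 2 = 2 * a ^ 2 + 2 * c ^ 2 - b ^ 2).
Proof.
intros Hl1 Hl2; pose proof (triangle_cross T) as H.
unfold admissible, bisector_A_length, bisector_B_length.
rewrite m_b_iff, !bisector_length_iff by (first [exact H|rewrite cross_rot; exact H]).
rewrite (eucl_dist_sym (vA T) (vC T)), (eucl_dist_sym (vB T) (vA T)).
unfold a, b, c, side_a, side_b, side_c; tauto.
Qed.

(** Here s^2 - d^2 = 4 a c and 4 x^2 - d^2 = s^2 - b^2, which turns the formula for l_b into the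
    curve equation. *)
Lemma admissible_curve (l1 l2 x : R) (T : plane_triangle)
    (s := side_c T + side_a T) (d := side_a T - side_c T) (b := side_b T) :
  0 < l1 -> 0 < l2 -> admissible l1 l2 x T ->
  0 <= x /\ d ^ 2 < b ^ 2 /\ median_bisector_curve (4 * x ^ 2) (4 * l1 ^ 2) s d b /\
  bisector_sq b ((s - d) / 2) (b - d) = l2 ^ 2.
Proof.
intros Hl1 Hl2 H; apply admissible_iff_sides in H; try lra.
destruct (triangle_sides T) as (Ha & Hb & Hc & H1 & H2 & H3).
unfold s, d, b; clear s d b; revert H Ha Hb Hc H1 H2 H3.
generalize (side_a T) (side_b T) (side_c T); intros a b c (E1 & E2 & Hx & E3) Ha Hb Hc H1 H2 H3.
split; [exact Hx|split; [nra|split]].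
- repeat split; try lra.
  + apply Rabs_le; lra.
  + transitivity (4 * (l1 ^ 2 * (a + c) ^ 2)); [rewrite E2, E3; ring|ring].
- unfold bisector_sq.
  replace ((c + a - (a - c)) / 2) with c by field.
  apply (Rmult_eq_reg_r ((c + b) ^ 2)); [|apply Rgt_not_eq, pow_lt; lra].
  rewrite E1; field; lra.
Qed.

(** The inequalities |d| < b < s are the triangle inequalities for the sides (s + d)/2, b and (s -
    d)/2. *)
Lemma admissible_of_curve (l1 l2 x s d b : R) :
  0 < l1 -> 0 < l2 -> 0 <= x -> bisector_gap l2 s d b = 0 ->
  0 < b -> d ^ 2 < b ^ 2 -> b < s -> b ^ 2 = s ^ 2 + d ^ 2 - 4 * x ^ 2 ->
  (s ^ 2 - d ^ 2) * (4 * x ^ 2 - d ^ 2) = 4 * l1 ^ 2 * s ^ 2 ->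
  exists T, admissible l1 l2 x T /\ side_a T - side_c T = d.
Proof.
intros Hl1 Hl2 Hx HG Hb Hd Hs E1 E2.
assert (d < b) by (apply pow2_lt_cancel; lra).
assert (- d < b) by (apply pow2_lt_cancel; [lra|replace ((- d) ^ 2) with (d ^ 2) by ring; exact Hd]).
destruct (triangle_exists ((s + d) / 2) b ((s - d) / 2)) as (T & Ea & Eb & Ec); try lra.
exists T; split; [|rewrite Ea, Ec; field].
apply admissible_iff_sides; try lra.
rewrite Ea, Eb, Ec; unfold bisector_gap in HG; repeat split; [|rewrite E1| |]; lra.
Qed.

(** On one branch l_a is strictly increasing in s, so equal l_a forces equal s; then d^2, the sign
    of d, and b are determined. *)
Lemma admissible_congruent (l1 l2 x : R) (T1 T2 : plane_triangle)
    (d1 := side_a T1 - side_c T1) (d2 := side_a T2 - side_c T2) :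
  0 < l1 -> 0 < l2 -> admissible l1 l2 x T1 -> admissible l1 l2 x T2 ->
  (0 <= d1 /\ 0 <= d2) \/ (d1 <= 0 /\ d2 <= 0) -> congruent T1 T2.
Proof.
intros Hl1 Hl2 A1 A2 Hd.
destruct (admissible_curve _ _ _ _ Hl1 Hl2 A1) as (_ & _ & C1 & L1).
destruct (admissible_curve _ _ _ _ Hl1 Hl2 A2) as (_ & _ & C2 & L2).
fold d1 in C1, L1; fold d2 in C2, L2.
assert (HL : 0 < 4 * l1 ^ 2) by nra.
destruct (Rtotal_order (side_c T1 + side_a T1) (side_c T2 + side_a T2)) as [Hs|[Hs|Hs]].
- pose proof (curve_bisector_lt _ _ _ _ _ _ _ _ HL Hs C1 C2 Hd); lra.
- rewrite Hs in C1; pose proof (curve_d_eq _ _ _ _ _ _ _ C1 C2) as Ed.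
  assert (E : d1 = d2).
  { destruct Hd as [Hd|Hd]; [apply pow2_eq_cancel; lra|].
    apply Ropp_eq_reg, pow2_eq_cancel; nra. }
  destruct C1 as (Hb1 & _ & _ & E1 & _), C2 as (Hb2 & _ & _ & E2 & _).
  assert (side_b T1 = side_b T2) by (apply pow2_eq_cancel; lra).
  unfold d1, d2 in E; apply sides_congruent; lra.
- assert (Hd' : (0 <= d2 /\ 0 <= d1) \/ (d2 <= 0 /\ d1 <= 0)) by tauto.
  pose proof (curve_bisector_lt _ _ _ _ _ _ _ _ HL Hs C2 C1 Hd'); lra.
Qed.

(** The curve equation rearranges to (4 x^2 - 4 l1^2) s^2 = d^2 (s^2 + 4 x^2 - d^2), whose right
    side is nonnegative and vanishes only for d = 0. *)
Lemma admissible_median_ge (l1 l2 x : R) (T : plane_triangle) :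
  0 < l1 -> 0 < l2 -> admissible l1 l2 x T ->
  l1 <= x /\ (x = l1 -> side_a T - side_c T = 0).
Proof.
intros Hl1 Hl2 H; destruct (admissible_curve _ _ _ _ Hl1 Hl2 H) as (Hx & _ & C & _).
pose proof (curve_bounds _ _ _ _ _ C) as B; destruct C as (_ & _ & _ & _ & E).
revert B E; generalize (side_a T - side_c T) (side_c T + side_a T); intros d s B E.
pose proof (pow2_ge_0 d).
assert (I : (4 * x ^ 2 - 4 * l1 ^ 2) * s ^ 2 = d ^ 2 * (s ^ 2 + 4 * x ^ 2 - d ^ 2)) by lra.
assert (Hs : 0 < s ^ 2) by lra.
split.
- apply pow2_le_cancel; [exact Hx|].
  assert (0 <= (4 * x ^ 2 - 4 * l1 ^ 2) * s ^ 2) by (rewrite I; apply Rmult_le_pos; lra).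
  nra.
- intros ->; rewrite Rminus_diag, Rmult_0_l in I.
  destruct (Rmult_integral _ _ (eq_sym I)) as [Z|Z]; [nra|lra].
Qed.

(** At the degenerate end b = d, so the positive term of the gap vanishes for every x >= l1. *)
Lemma admissible_exists_nonneg (l1 l2 x : R) :
  0 < l1 -> 0 < l2 -> l1 <= x ->
  exists T, admissible l1 l2 x T /\ 0 <= side_a T - side_c T.
Proof.
intros Hl1 Hl2 Hx.
destruct (curve_exists x l1 l2 1) as (s & d & b & HG & Hd & _ & C); try lra.
- rewrite Rmult_1_l, Rabs_pos_eq by apply sqrt_pos.
  pose proof (sqrt_pos (curve_dsq (4 * x ^ 2) (4 * l1 ^ 2) (2 * x))).
  set (e := sqrt _) in *; unfold bisector_gap.
  assert (0 < l2 ^ 2 * (2 * e + 2 * x - e) ^ 2) by (apply Rmult_lt_0_compat; apply pow_lt; lra).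
  lra.
- destruct (admissible_of_curve l1 l2 x s d b) as (T & HT & Ed); try tauto; try lra.
  exists T; split; [exact HT|lra].
Qed.

(** * The branch d < 0 and its flat end *)

(** The side b of the flat triangle with s = 2x: there the curve equation becomes (4 x^2 - b^2)^2 =
    (4 x l1)^2. *)
Definition degenerate_side (l1 x : R) : R := 2 * sqrt (x * (x - l1)).

Lemma degenerate_side_spec (l1 x : R) (e := degenerate_side l1 x) :
  0 < l1 -> l1 < x -> 0 < e /\ e ^ 2 = 4 * x ^ 2 - 4 * x * l1 /\ e < 2 * x.
Proof.
intros Hl1 Hx; unfold e, degenerate_side; clear e.
assert (P : 0 < x * (x - l1)) by nra.
pose proof (sqrt_lt_R0 _ P); pose proof (pow2_sqrt _ (Rlt_le _ _ P)).
repeat split; try nra.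
Qed.

Lemma curve_dsq_degenerate (l1 x : R) :
  0 < l1 -> l1 < x ->
  sqrt (curve_dsq (4 * x ^ 2) (4 * l1 ^ 2) (2 * x)) = degenerate_side l1 x.
Proof.
intros Hl1 Hx; destruct (degenerate_side_spec l1 x Hl1 Hx) as (He & E & _).
destruct (curve_dsq_spec (4 * x ^ 2) (4 * l1 ^ 2) (2 * x)) as (H1 & H2 & H3 & _); try nra.
apply pow2_eq_cancel; [apply sqrt_pos|lra|].
rewrite pow2_sqrt, E by exact H1.
enough (4 * x ^ 2 - curve_dsq (4 * x ^ 2) (4 * l1 ^ 2) (2 * x) = 4 * x * l1) by lra.
apply pow2_eq_cancel; nra.
Qed.

(** The hypothesis bounds by l2 the harmonic mean of b = e and c = x + e/2, which is l_a at the flat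
    end; the gap there is the difference of the squares of its two sides. *)
Lemma admissible_exists_neg (l1 l2 x : R) (e := degenerate_side l1 x) :
  0 < l1 -> 0 < l2 -> l1 < x -> 2 * e * (2 * x + e) < l2 * (2 * x + 3 * e) ->
  exists T, admissible l1 l2 x T /\ side_a T - side_c T < 0.
Proof.
intros Hl1 Hl2 Hx He.
destruct (degenerate_side_spec l1 x Hl1 Hx) as (He0 & _ & _); fold e in He0.
destruct (curve_exists x l1 l2 (-1)) as (s & d & b & HG & Hd & Hd0 & C); try lra.
- rewrite curve_dsq_degenerate by assumption; fold e.
  replace (-1 * e) with (- e) by ring; rewrite Rabs_Ropp, Rabs_pos_eq by lra.
  unfold bisector_gap.
  assert (0 < 2 * e * (2 * x + e)) by nra.
  assert ((2 * e * (2 * x + e)) ^ 2 < (l2 * (2 * x + 3 * e)) ^ 2) by nra.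
  lra.
- destruct (admissible_of_curve l1 l2 x s d b) as (T & HT & Ed); try tauto; try lra.
  exists T; split; [exact HT|specialize (Hd0 Hx); lra].
Qed.

(** The flat triangle is itself a point of the curve, so strict monotonicity of l_a compares it with
    T. *)
Lemma admissible_neg_bound (l1 l2 x : R) (T : plane_triangle) (e := degenerate_side l1 x) :
  0 < l1 -> 0 < l2 -> l1 < x -> admissible l1 l2 x T -> side_a T - side_c T < 0 ->
  2 * e * (2 * x + e) < l2 * (2 * x + 3 * e).
Proof.
intros Hl1 Hl2 Hx HT Hd.
destruct (degenerate_side_spec l1 x Hl1 Hx) as (He0 & E & He1); fold e in He0, E, He1.
destruct (admissible_curve _ _ _ _ Hl1 Hl2 HT) as (_ & Hdb & C & L).
assert (C0 : median_bisector_curve (4 * x ^ 2) (4 * l1 ^ 2) (2 * x) (- e) e).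
{ repeat split; try lra.
  - rewrite Rabs_Ropp, Rabs_pos_eq; lra.
  - replace ((- e) ^ 2) with (e ^ 2) by ring; rewrite E; ring. }
assert (Hs : 2 * x < side_c T + side_a T).
{ destruct C as (_ & _ & Hbs & E1 & _); destruct (triangle_sides T) as (? & ? & ? & _).
  apply pow2_lt_cancel; nra. }
assert (K := curve_bisector_lt (4 * x ^ 2) (4 * l1 ^ 2) _ _ _ _ _ _ ltac:(nra) Hs C0 C ltac:(lra)).
rewrite L in K.
assert (Q : 0 < 2 * x + 3 * e) by lra.
replace (bisector_sq e ((2 * x - - e) / 2) (e - - e))
  with ((2 * e * (2 * x + e) / (2 * x + 3 * e)) ^ 2) in K by (unfold bisector_sq; field; lra).
apply pow2_lt_cancel in K; [|lra].
apply Rlt_div_l in K; lra.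
Qed.

(** The pair (m, b) describes a flat triangle with l_a = l2. The harmonic mean increases in both
    sides, and e is ordered against b as x against m. *)
Lemma degenerate_bisector_lt_iff (l2 m x b e : R) :
  0 < b -> 0 < e -> 0 < m -> 0 < x ->
  2 * b * (2 * m + b) = l2 * (2 * m + 3 * b) ->
  (e < b <-> x < m) ->
  (2 * e * (2 * x + e) < l2 * (2 * x + 3 * e) <-> x < m).
Proof.
intros Hb He Hm Hx E Hiff.
(* difference of the two cross-multiplied harmonic means *)
assert (I : (l2 * (2 * x + 3 * e) - 2 * e * (2 * x + e)) * (2 * m + 3 * b)
  = 2 * ((b - e) * (2 * m + b) * (2 * x + e) + b * e * ((2 * m + b) - (2 * x + e)) * 2)).
{ transitivity ((l2 * (2 * m + 3 * b)) * (2 * x + 3 * e) - 2 * e * (2 * x + e) * (2 * m + 3 * b)); [ring|].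
  rewrite <- E; ring. }
assert (P1 : 0 < (2 * m + b) * (2 * x + e)) by (apply Rmult_lt_0_compat; lra).
assert (P2 : 0 < b * e) by (apply Rmult_lt_0_compat; lra).
split.
- intros H; apply Rnot_le_lt; intros C.
  assert (b <= e) by (apply Rnot_lt_le; intros F; apply Hiff in F; lra).
  assert (0 <= (e - b) * ((2 * m + b) * (2 * x + e))) by (apply Rmult_le_pos; lra).
  assert (0 <= b * e * ((2 * x + e) - (2 * m + b))) by (apply Rmult_le_pos; lra).
  assert (0 < (l2 * (2 * x + 3 * e) - 2 * e * (2 * x + e)) * (2 * m + 3 * b)) by (apply Rmult_lt_0_compat; lra).
  lra.
- intros H; assert (e < b) by (apply Hiff, H).
  assert (0 < (b - e) * ((2 * m + b) * (2 * x + e))) by (apply Rmult_lt_0_compat; lra).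
  assert (0 < b * e * ((2 * m + b) - (2 * x + e))) by (apply Rmult_lt_0_compat; lra).
  apply (Rmult_lt_reg_r (2 * m + 3 * b)); lra.
Qed.

(** * The critical flat triangle *)

(** In a flat triangle with c = a + b, l_b and l_a are the harmonic means of a, c and of b, c.
    Setting them to l1 and l2 reduces c = a + b to (2 c - l1 - l2)^2 = l1^2 + l2^2 - l1 l2. *)
Lemma star_spec (l1 l2 : R) :
  0 < l1 -> 0 < l2 ->
  let c := / 2 * (l1 + l2 + sqrt (l1 ^ 2 + l2 ^ 2 - l1 * l2)) in
  let a := c / (2 * c / l1 - 1) in
  let b := c / (2 * c / l2 - 1) in
  0 < a /\ 0 < b /\ c = a + b /\ 2 * a * c = l1 * (a + c) /\ 2 * b * c = l2 * (b + c).
Proof.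
intros Hl1 Hl2 c a b.
assert (N : 0 < l1 ^ 2 + l2 ^ 2 - l1 * l2)
  by (pose proof (pow2_ge_0 (l1 - l2)); assert (0 < l1 * l2) by (apply Rmult_lt_0_compat; assumption); lra).
pose proof (sqrt_lt_R0 _ N) as P; pose proof (pow2_sqrt _ (Rlt_le _ _ N)) as Q.
set (r := sqrt _) in *; clearbody r.
assert (Ec : 2 * c = l1 + l2 + r) by (unfold c; field).
clearbody c.
assert (Ha : a = c * l1 / (2 * c - l1)) by (unfold a; field; lra).
assert (Hb : b = c * l2 / (2 * c - l2)) by (unfold b; field; lra).
clearbody a b.
repeat split.
- rewrite Ha; apply Rdiv_lt_0_compat; nra.
- rewrite Hb; apply Rdiv_lt_0_compat; nra.
- apply (Rmult_eq_reg_r ((2 * c - l1) * (2 * c - l2))); [|apply Rgt_not_eq, Rmult_lt_0_compat; lra].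
  transitivity (c * (l1 * (2 * c - l2) + l2 * (2 * c - l1))); [|rewrite Ha, Hb; field; lra].
  f_equal; assert ((2 * c - l1 - l2) ^ 2 = r ^ 2) by (f_equal; lra); lra.
- rewrite Ha; field; lra.
- rewrite Hb; field; lra.
Qed.

Lemma neg_criterion (l1 l2 x : R) :
  0 < l1 -> 0 < l2 ->
  let c := / 2 * (l1 + l2 + sqrt (l1 ^ 2 + l2 ^ 2 - l1 * l2)) in
  let a := c / (2 * c / l1 - 1) in
  let b := c / (2 * c / l2 - 1) in
  let m := a + / 2 * b in
  let e := degenerate_side l1 x in
  l1 < m /\
  (l1 < x -> (2 * e * (2 * x + e) < l2 * (2 * x + 3 * e) <-> x < m)).
Proof.
intros Hl1 Hl2 c a b m e.
destruct (star_spec l1 l2 Hl1 Hl2) as (Ha & Hb & Hc & E1 & E2); fold c a b in Ha, Hb, Hc, E1, E2.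
assert (Ea : a = m - b / 2) by (unfold m; field).
assert (Ec : c = m + b / 2) by (rewrite Hc, Ea; field).
clearbody m; clearbody a b c; subst a c.
(* This identifies b as the degenerate side for the median m. *)
assert (Hm : b ^ 2 = 4 * m * (m - l1)) by lra.
assert (Hlm : l1 < m) by nra.
split; [exact Hlm|intros Hx].
destruct (degenerate_side_spec l1 x Hl1 Hx) as (He & Ee & _); fold e in He, Ee.
refine (degenerate_bisector_lt_iff l2 m x b e _ _ _ _ _ _); try lra.
split; intros H.
- apply Rnot_le_lt; intros C; assert (m * (m - l1) <= x * (x - l1)) by nra; nra.
- apply pow2_lt_cancel; nra.
Qed.

Theorem mainTheorem11 :
  forall l1 l2 : R, 0 < l2 -> l2 <= l1 ->
  let c_star := / 2 * (l1 + l2 + sqrt (l1 ^ 2 + l2 ^ 2 - l1 * l2)) in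
  let a_star := c_star / (2 * c_star / l1 - 1) in
  let b_star := c_star / (2 * c_star / l2 - 1) in
  let m_star := a_star + / 2 * b_star in
  forall x : R,
  let admissible := fun T : plane_triangle =>
    bisector_A_length T l2 /\ bisector_B_length T l1 /\ m_b T = x in
  (l1 < x < m_star -> exactly_two_up_to_congruence admissible) /\
  (m_star <= x \/ x = l1 -> unique_up_to_congruence admissible) /\
  (~ (l1 < x < m_star) -> ~ (m_star <= x \/ x = l1) -> no_triangle admissible).
Proof.
intros l1 l2 Hl2 Hl c_star a_star b_star m_star x adm.
assert (Hl1 : 0 < l1) by lra.
destruct (neg_criterion l1 l2 x Hl1 Hl2) as [Hm Hcrit].
fold c_star a_star b_star m_star in Hm, Hcrit.
assert (Hge : forall T, adm T -> l1 <= x /\ (x = l1 -> side_a T - side_c T = 0))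
  by (intros T HT; exact (admissible_median_ge l1 l2 x T Hl1 Hl2 HT)).
assert (Hcong := fun T1 T2 => admissible_congruent l1 l2 x T1 T2 Hl1 Hl2).
change (admissible l1 l2 x) with adm in Hcong.
split; [|split].
- intros [Hx1 Hx2].
  destruct (admissible_exists_nonneg l1 l2 x) as (T1 & HT1 & H1); try lra.
  destruct (admissible_exists_neg l1 l2 x) as (T2 & HT2 & H2); try lra.
  exists T1, T2; split; [exact HT1|split; [exact HT2|split]].
  (* The two triangles have opposite signs of a - c, with a - c < 0 for the second. *)
  + intros C; apply congruent_sides in C; lra.
  + intros T HT; destruct (Rle_or_lt 0 (side_a T - side_c T)).
    * left; apply Hcong; auto.
    * right; apply Hcong; auto; lra.
- intros Hx.
  destruct (admissible_exists_nonneg l1 l2 x) as (T1 & HT1 & H1); try lra.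
  exists T1; split; [exact HT1|].
  intros T HT; apply Hcong; auto; left; split; [|exact H1].
  (* The branch a - c < 0 is empty: x = l1 forces a = c, and for x >= m_star the flat end already
     has l_a >= l2. *)
  apply Rnot_lt_le; intros H2.
  destruct (Hge T HT) as [_ Hiso].
  destruct (Req_dec x l1) as [E|Hne]; [specialize (Hiso E); lra|].
  assert (Hx1 : l1 < x) by lra.
  pose proof (admissible_neg_bound l1 l2 x T Hl1 Hl2 Hx1 HT H2) as K.
  apply Hcrit in K; lra.
- intros N1 N2 T HT; destruct (Hge T HT) as [Hx _].
  destruct (Rle_or_lt m_star x); [tauto|].
  destruct Hx as [Hx|Hx]; [tauto|symmetry in Hx; tauto].
Qed.
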